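(* Let $f=\sum_{S\subseteq[n]}c_S\,\mathbf{x}^{[n]\setminus S}y^{|S|}\in\mathbb{R}[x_1,\dots,x_n,y]$ be a Lorentzian polynomial, where $\mathbf{x}^T=\prod_{i\in T}x_i$. If $n\ge4$, then for all distinct $a,b,c,d\in[n]$, all $S\subseteq[n]\setminus\{a,b,c,d\}$ and all $r\in\mathbb{R}$, \[ (r+1)\,c_{S\cup\{a,d\}}c_{S\cup\{b,c\}}+r(r+1)\,c_{S\cup\{a,c\}}c_{S\cup\{b,d\}}\;\ge\; r\,c_{S\cup\{a,b\}}c_{S\cup\{c,d\}} . \] If $n\ge3$, then for all distinct $a,b,c\in[n]$, all $S\subseteq[n]\setminus\{a,b,c\}$ and all $r\in\mathbb{R}$, \[ (r+1)\,c_{S\cup\{a\}}c_{S\cup\{b,c\}}+r(r+1)\,c_{S\cup\{b\}}c_{S\cup\{a,c\}}\;\ge\; r\,c_{S\cup\{c\}}c_{S\cup\{a,b\}} . \] Moreover, both inequalities are tight on the subclass of such polynomials whose coefficients are $c_S=A_S$ for an $n\times n$ real symmetric positive semidefinite matrix $A$: for every $r\in\mathbb{R}$, the infimum over this subclass of the left-hand side minus the right-hand side is $0$.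
   Context: A homogeneous polynomial $g\in\mathbb{R}[z_1,\dots,z_m]$ of degree $d$ is Lorentzian if: for $d\le1$, its coefficients are nonnegative; for $d\ge2$, its coefficients are nonnegative, its support $J\subseteq\mathbb{Z}_{\ge0}^m$ is M-convex (for all $\alpha,\beta\in J$ and $i$ with $\alpha_i>\beta_i$ there is $j$ with $\alpha_j<\beta_j$ and $\alpha-e_i+e_j\in J$), and for every multi-index $\alpha$ with $|\alpha|=d-2$ the Hessian matrix of the quadratic form $\partial^\alpha g$ has at most one positive eigenvalue. $A_S$ denotes the principal minor of $A$ on rows and columns $S$ ($A_\emptyset=1$). *)

(* Defs.v *)
From HB Require Import structures.
From mathcomp Require Import all_boot all_order all_algebra.
From mathcomp Require Import reals.
From mathcomp Require Import mpoly.
Set Implicit Arguments. Unset Strict Implicit. Unset Printing Implicit Defensive.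
Import Order.TTheory GRing.Theory Num.Theory.
Local Open Scope ring_scope.

Section Defs.
Variable R : realType.

(* The eigenvalues of a square matrix A, counted with multiplicity, are the
   roots (with multiplicity) of its characteristic polynomial.  "A has at
   most one positive eigenvalue" means: char_poly A does not have two positive
   roots counted with multiplicity, i.e. no product (X - x)(X - y) with
   x, y > 0 (possibly x = y) divides char_poly A. *)
Definition at_most_one_pos_eig (m : nat) (A : 'M[R]_m) : Prop :=
  forall x y : R, 0 < x -> 0 < y ->
    ~~ ((('X - x%:P) * ('X - y%:P)) %| char_poly A)%R.

(* Hessian matrix of a (quadratic) polynomial q: entries d_i d_j q, which
   are constants for a quadratic form; we read off the constant term. *)
Definition hessian (m : nat) (q : {mpoly R[m]}) : 'M[R]_m :=
  \matrix_(i, j) (mderiv i (mderiv j q))@_0%MM.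

Definition homogeneous_of_degree (m : nat) (g : {mpoly R[m]}) (d : nat) :=
  forall mu : 'X_{1..m}, mu \in msupp g -> mdeg mu = d.

Definition Mconvex (m : nat) (J : seq 'X_{1..m}) : Prop :=
  forall alpha beta : 'X_{1..m}, alpha \in J -> beta \in J ->
  forall i : 'I_m, (beta i < alpha i)%N ->
  exists j : 'I_m, (alpha j < beta j)%N /\ ((alpha - U_(i)) + U_(j))%MM \in J.

Definition Lorentzian (m : nat) (g : {mpoly R[m]}) (d : nat) : Prop :=
  homogeneous_of_degree g d /\
  (forall mu : 'X_{1..m}, 0 <= g@_mu) /\
  ((2 <= d)%N ->
     Mconvex (msupp g) /\
     forall alpha : 'X_{1..m}, mdeg alpha = (d - 2)%N ->
       at_most_one_pos_eig (hessian (mderivm alpha g))).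

Definition xvar (n : nat) (i : 'I_n) : {mpoly R[n.+1]} :=
  'X_(widen_ord (leqnSn n) i).
Definition yvar (n : nat) : {mpoly R[n.+1]} := 'X_(@ord_max n).

Definition fpoly (n : nat) (c : {set 'I_n} -> R) : {mpoly R[n.+1]} :=
  \sum_(S : {set 'I_n}) c S *: ((\prod_(i in ~: S) xvar i) * yvar n ^+ #|S|).

Definition principal_minor (n : nat) (A : 'M[R]_n) (S : {set 'I_n}) : R :=
  \det (mxsub (fun k : 'I_#|S| => enum_val k) (fun k : 'I_#|S| => enum_val k) A).

Definition psd (n : nat) (A : 'M[R]_n) : Prop :=
  A^T = A /\ forall v : 'cV[R]_n, 0 <= (v^T *m A *m v) 0 0.

Definition gap4 (n : nat) (c : {set 'I_n} -> R) (a b c' d : 'I_n)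
    (S : {set 'I_n}) (r : R) : R :=
  (r + 1) * c (S :|: [set a; d]) * c (S :|: [set b; c'])
  + r * (r + 1) * c (S :|: [set a; c']) * c (S :|: [set b; d])
  - r * c (S :|: [set a; b]) * c (S :|: [set c'; d]).

Definition gap3 (n : nat) (c : {set 'I_n} -> R) (a b c' : 'I_n)
    (S : {set 'I_n}) (r : R) : R :=
  (r + 1) * c (S :|: [set a]) * c (S :|: [set b; c'])
  + r * (r + 1) * c (S :|: [set b]) * c (S :|: [set a; c'])
  - r * c (S :|: [set c']) * c (S :|: [set a; b]).

End Defs.

(* Main.v *)
Require Import Defs.
From HB Require Import structures.
From mathcomp Require Import all_boot all_order all_algebra.
From mathcomp Require Import reals.
From mathcomp Require Import mpoly complex spectral sesquilinear ring lra.
Set Implicit Arguments. Unset Strict Implicit. Unset Printing Implicit Defensive.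
Import Order.TTheory GRing.Theory Num.Theory.
Local Open Scope ring_scope.

(* Fix V and set alpha = x^([n] \ V) y^(|V| - 2).  The Hessian of the quadratic
   form d^alpha f, restricted to four variables including at least three x's,
   has nonnegative entries H_ij (factorial multiples of the c_T) and vanishing
   diagonal on the x's.  When H_ij > 0 the vector e_i + e_j is positive, so the
   form is nonpositive on the H-orthogonal complement of e_i, e_j inside the
   span of the four basis vectors.  The discriminant of that binary form gives
     (X - Y - Z)^2 <= 4 Y Z,
   with X = H_ij H_kl, Y = H_ik H_jl, Z = H_il H_jk, which is symmetric in
   X, Y, Z and says precisely that Y r^2 + (Y + Z - X) r + Z >= 0 for all r.
   For four indices all variables are x's; for three, the fourth one is y.
   Tightness is witnessed by A = 0, where f = x_1 ... x_n. *)

(** * Real symmetric matrices with at most one positive eigenvalue *)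

Section Spectral.
Local Open Scope sesquilinear_scope.
Variable R : realType.
Notation C := R[i].
Notation toC := (real_complex R).

Lemma toC_conj (x : R) : (toC x)^* = toC x.
Proof. by apply/CrealP/complex_realP; exists x. Qed.

Lemma char_poly_similar (F : comNzRingType) n (P Q D : 'M[F]_n) :
  P *m Q = 1%:M -> char_poly (Q *m D *m P) = char_poly D.
Proof.
move=> PQ1; have QP1 := mulmx1C PQ1.
rewrite /char_poly.
have -> : char_poly_mx (Q *m D *m P)
    = map_mx polyC Q *m char_poly_mx D *m map_mx polyC P.
  rewrite /char_poly_mx mulmxBr mulmxBl scalar_mxC.
  rewrite -[_%:M *m _ *m _]mulmxA -!map_mxM.
  by rewrite QP1 map_mx1 mulmx1.
by rewrite !det_mulmx mulrAC -det_mulmx -map_mxM QP1 map_mx1 det1 mul1r.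
Qed.

(** The spectral theorem is applied over [C]. Eigenvalues of a Hermitian matrix are real, so the
    factorization of the characteristic polynomial descends to [R] by injectivity of [map_poly]. *)
Lemma symmetric_spectral n (H : 'M[R]_n) : H^T = H ->
  exists (P : 'M[C]_n) (d : 'rV[R]_n),
    [/\ P \is unitarymx, map_mx toC H = P^t* *m diag_mx (map_mx toC d) *m P
      & char_poly H = \prod_i ('X - (d 0 i)%:P)].
Proof.
move=> Hsym; pose A := map_mx toC H.
have Ah : A \is hermsymmx.
  apply: realsym_hermsym.
    apply/is_hermitianmxP; rewrite expr0 scale1r map_mx_id //.
    by rewrite /A map_trmx Hsym.
  by apply/mxOverP=> i j; rewrite mxE; apply/complex_realP; exists (H i j).
have /mxOverP dr := hermitian_spectral_diag_real Ah.
have /orthomx_spectralP eA := hermitian_normalmx Ah.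
have Pu := spectral_unitarymx A.
pose d := \row_j complex.Re (spectral_diag A 0 j).
have ed : spectral_diag A = map_mx toC d.
  by apply/rowP=> j; rewrite !mxE RRe_real.
exists (spectralmx A), d; split=> //.
  by rewrite -ed -invmx_unitary.
apply: (map_poly_inj toC); rewrite map_char_poly -/A eA ed.
rewrite char_poly_similar ?mulmxV ?unitarymx_unit //.
rewrite char_poly_trig ?diag_mx_is_trig // rmorph_prod.
apply: eq_bigr => i _.
by rewrite !mxE eqxx mulr1n rmorphB /= map_polyX map_polyC.
Qed.

(** Sesquilinear and complex because the unitary diagonalization lives over [C]; [form_real]
    recovers the real bilinear form. *)
Definition form n (H : 'M[R]_n) (u v : 'rV[C]_n) : C :=
  (u *m map_mx toC H *m v^t*) 0 0.

Lemma formZ n (H : 'M[R]_n) (a b : C) u v :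
  form H (a *: u) (b *: v) = a * b^* * form H u v.
Proof.
by rewrite /form linearZ map_mxZ /= -!scalemxAl -scalemxAr !mxE mulrA.
Qed.

Lemma formB n (H : 'M[R]_n) u v :
  form H (u - v) (u - v)
  = form H u u - form H u v - form H v u + form H v v.
Proof.
rewrite /form linearB map_mxB /= !mulmxBl !mulmxBr !mxE.
ring.
Qed.

(** The cross terms vanish, leaving |b|^2 Q(u) + |a|^2 Q(w). Below, [a] and [b] are chosen to cancel
    one coordinate of the combination, which then contradicts this positivity. *)
Lemma form_comb_gt0 n (H : 'M[R]_n) u w (a b : C) :
  0 < form H u u -> 0 < form H w w -> form H u w = 0 -> form H w u = 0 ->
  a != 0 -> 0 < form H (b *: u - a *: w) (b *: u - a *: w).
Proof.
move=> Qu Qw uw wu a0; rewrite formB !formZ uw wu !mulr0 !subr0 -!normCK.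
by rewrite ltr_wpDl ?mulr_ge0 ?mulr_gt0 ?exprn_ge0 ?exprn_gt0 ?normr_gt0 // ltW.
Qed.

Lemma form_spectral n (H : 'M[R]_n) (P : 'M[C]_n) (d : 'rV[R]_n) u v :
  map_mx toC H = P^t* *m diag_mx (map_mx toC d) *m P ->
  form H u v
  = \sum_i toC (d 0 i) * ((u *m P^t*) 0 i * ((v *m P^t*) 0 i)^*).
Proof.
move=> eH; rewrite /form eH !mulmxA -mulmxA.
have -> : P *m v^t* = (v *m P^t*)^t*.
  by rewrite trmx_mul map_mxM /= trmxCK.
rewrite mul_mx_diag mxE; apply: eq_bigr => i _.
by rewrite !mxE -mulrA mulrCA.
Qed.

Lemma form_real n (H : 'M[R]_n) (u v : 'rV[R]_n) :
  form H (map_mx toC u) (map_mx toC v) = toC ((u *m H *m v^T) 0 0).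
Proof.
rewrite /form -map_mxM [in LHS]map_trmx -map_mx_comp.
have -> : map_mx (Num.conj \o toC) v^T = map_mx toC v^T.
  by apply/matrixP=> i j; rewrite !mxE /= toC_conj.
by rewrite -map_mxM mxE.
Qed.

Lemma form_le0 n (H : 'M[R]_n) (P : 'M[C]_n) (d : 'rV[R]_n) u :
  map_mx toC H = P^t* *m diag_mx (map_mx toC d) *m P ->
  (forall i, 0 < d 0 i -> (u *m P^t*) 0 i = 0) -> form H u u <= 0.
Proof.
move=> eH ud; rewrite (form_spectral _ _ eH) sumr_le0 // => i _.
case: (ltrP 0 (d 0 i)) => [/ud ->|di]; first by rewrite mul0r mulr0.
by rewrite -normCK mulr_le0_ge0 ?exprn_ge0 // lecR.
Qed.

Lemma root_prod_XsubC_in (I : finType) (D : pred I) (e : I -> R) (x : R) :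
  root (\prod_(i | D i) ('X - (e i)%:P)) x -> exists2 i, D i & e i = x.
Proof.
rewrite rootE horner_prod => /prodf_eq0 [i Di].
by rewrite hornerXsubC subr_eq0 => /eqP ex; exists i.
Qed.

(** Comparing indices rather than values accounts for multiplicity: after one factor X - x is
    cancelled, y must be a root of the product over the other indices. *)
Lemma at_most_one_pos_eigP n (H : 'M[R]_n) (d : 'rV[R]_n) :
  char_poly H = \prod_i ('X - (d 0 i)%:P) ->
  at_most_one_pos_eig H <-> (forall i j, 0 < d 0 i -> 0 < d 0 j -> i = j).
Proof.
rewrite /at_most_one_pos_eig => ->; split=> [H1 i j di dj|H1 x y x0 y0].
  apply: contraNeq (H1 _ _ di dj) => ij.
  rewrite (bigD1 i) //= (bigD1 j) 1?eq_sym //= mulrA.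
  exact: dvdp_mulr.
apply/negP => dv.
have [i _ di] : exists2 i : 'I_n, true & d 0 i = x.
  apply: root_prod_XsubC_in; rewrite -dvdp_XsubCl.
  exact: dvdp_trans (dvdp_mulr _ (dvdpp _)) dv.
move: dv; rewrite (bigD1 i) //= di dvdp_mul2l ?polyXsubC_eq0 // dvdp_XsubCl.
by case/root_prod_XsubC_in => j /negP ji dj; apply/ji/eqP/H1; rewrite ?di ?dj.
Qed.

(* If two eigenvalues cannot both be positive, some vector of the plane spanned
   by [u] and [w] has no component along the positive eigenvector. *)
Lemma at_most_one_pos_eig_plane n (H : 'M[R]_n) (u w : 'rV[R]_n) :
  H^T = H -> at_most_one_pos_eig H ->
  0 < (u *m H *m u^T) 0 0 -> (u *m H *m w^T) 0 0 = 0 ->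
  (w *m H *m w^T) 0 0 <= 0.
Proof.
move=> Hsym H1 uu uw; rewrite leNgt; apply/negP => ww.
have wu : (w *m H *m u^T) 0 0 = 0.
  have -> : w *m H *m u^T = (u *m H *m w^T)^T.
    by rewrite !trmx_mul trmxK Hsym mulmxA.
  by rewrite mxE uw.
have [P [d [Pu eH eC]]] := symmetric_spectral Hsym.
have {}H1 := (at_most_one_pos_eigP eC).1 H1.
pose u' := map_mx toC u; pose w' := map_mx toC w.
have fuu : 0 < form H u' u' by rewrite form_real ltcR.
have fww : 0 < form H w' w' by rewrite form_real ltcR.
have fuw : form H u' w' = 0 by rewrite form_real uw.
have fwu : form H w' u' = 0 by rewrite form_real wu.
(* Without a component along a positive eigenvector, [u'] would have a nonpositive form value. *)
have [i di ui] : exists2 i, 0 < d 0 i & (u' *m P^t*) 0 i != 0.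
  case: (pickP (fun i => (0 < d 0 i) && ((u' *m P^t*) 0 i != 0)))
    => [i /andP[]|h].
    by exists i.
  suff : form H u' u' <= 0 by rewrite lt_geF.
  apply: form_le0 eH _ => i di.
  by apply/eqP; have := h i; rewrite di => /negbFE.
(* This combination has [i]-th spectral coordinate 0, and [i] is the only positive index. *)
suff : form H ((w' *m P^t*) 0 i *: u' - (u' *m P^t*) 0 i *: w')
              ((w' *m P^t*) 0 i *: u' - (u' *m P^t*) 0 i *: w') <= 0.
  by rewrite lt_geF ?form_comb_gt0.
apply: form_le0 eH _ => j dj; rewrite (H1 _ _ dj di) mulmxBl -!scalemxAl !mxE.
by rewrite mulrC subrr.
Qed.

(* Two positive eigenvectors would span a vector whose [k]-th coordinate is 0,
   and the form vanishes on such vectors. *)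
Lemma at_most_one_pos_eig_cross n (H : 'M[R]_n) (k : 'I_n) :
  H^T = H -> (forall i j, i != k -> j != k -> H i j = 0) ->
  at_most_one_pos_eig H.
Proof.
move=> Hsym Hk.
have [P [d [Pu eH eC]]] := symmetric_spectral Hsym.
apply/(at_most_one_pos_eigP eC) => i j di dj; apply/eqP/negP => /negP ij.
have isotropic (u : 'rV[C]_n) : u 0 k = 0 -> form H u u = 0.
  move=> uk; rewrite /form mxE big1 // => l _.
  have [->|lk] := eqVneq l k; first by rewrite !mxE uk rmorph0 mulr0.
  rewrite mxE big1 ?mul0r // => m _; rewrite mxE.
  by have [->|mk] := eqVneq m k; rewrite ?uk ?mul0r // Hk ?rmorph0 ?mulr0.
have formP p q : form H (row p P) (row q P) = (p == q)%:R * toC (d 0 p).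
  rewrite (form_spectral _ _ eH) (bigD1 p) //= big1 ?addr0 => [|l lp];
    rewrite -!row_mul (unitarymxP Pu) !mxE ?eqxx.
    by rewrite mul1r rmorph_nat mulrC eq_sym.
  by rewrite eq_sym (negPf lp) mul0r mulr0.
have fi : 0 < form H (row i P) (row i P) by rewrite formP eqxx mul1r ltcR.
have fj : 0 < form H (row j P) (row j P) by rewrite formP eqxx mul1r ltcR.
have Pik : P i k != 0.
  by apply: contraTneq fi => Pik; rewrite isotropic ?ltxx // mxE.
suff : 0 < form H (P j k *: row i P - P i k *: row j P)
                  (P j k *: row i P - P i k *: row j P).
  by rewrite isotropic ?ltxx // !mxE mulrC subrr.
by rewrite form_comb_gt0 // formP ?(negPf ij) 1?eq_sym ?(negPf ij) mul0r.
Qed.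
End Spectral.

(** * Discriminant inequalities for entries of such a matrix *)

Section Quadric.
Variable R : realType.

Lemma disc_le_of_form_ge0 (a b D : R) : 0 <= a -> 0 <= b ->
  (forall s t : R, 0 <= a * s ^+ 2 - D * (s * t) + b * t ^+ 2) ->
  D ^+ 2 <= 4 * (a * b).
Proof.
move=> a0 b0 form0; have [{}a0|a_eq0] : 0 < a \/ a = 0.
- by move: a0; rewrite le_eqVlt eq_sym => /orP[/eqP|]; [right|left].
(* For fixed t = 2a, the form is minimal at s = D. *)
- have := form0 D (2 * a).
  have -> : a * D ^+ 2 - D * (D * (2 * a)) + b * (2 * a) ^+ 2
            = a * (4 * (a * b) - D ^+ 2) by ring.
  by rewrite pmulr_rge0 // subr_ge0.
(* With a = 0, the value at (b + 1, D) is -D^2, so D = 0. *)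
- have := form0 (b + 1) D; rewrite a_eq0; lra.
Qed.

Lemma quad_ge0_of_disc (X Y Z r : R) : 0 <= Y -> 0 <= Z ->
  (X - Y - Z) ^+ 2 <= 4 * (Y * Z) ->
  r * X <= (r + 1) * Z + r * (r + 1) * Y.
Proof.
move=> Y0 Z0 disc; have [{}Y0|Y_eq0] : 0 < Y \/ Y = 0.
- by move: Y0; rewrite le_eqVlt eq_sym => /orP[/eqP|]; [right|left].
(* Completing the square: 4Y times the difference is (2Yr + Y + Z - X)^2 + 4YZ - (X - Y - Z)^2. *)
- rewrite -subr_ge0 -(pmulr_rge0 _ (_ : 0 < 4 * Y)) ?mulr_gt0 //.
  have := sqr_ge0 (2 * Y * r + (Y + Z - X)); lra.
(* If Y = 0, the discriminant bound forces X = Z, and the difference is Z. *)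
- suff : (X - Z) ^+ 2 == 0.
    by rewrite expf_eq0 subr_eq0 => /eqP ->; rewrite Y_eq0; lra.
  by rewrite eq_le sqr_ge0 andbT; move: disc; rewrite Y_eq0; lra.
Qed.

Lemma hessian_disc n (H : 'M[R]_n) (i j k l : 'I_n) :
  H^T = H -> at_most_one_pos_eig H -> (forall p q, 0 <= H p q) ->
  H i i = 0 -> H j j = 0 -> H k k = 0 -> 0 < H i j ->
  (H i j * H k l - H i k * H j l - H j k * H i l) ^+ 2
  <= 4 * ((H i k * H j l) * (H j k * H i l)).
Proof.
move=> Hsym H1 H0 ii jj kk ij.
pose B (u v : 'rV[R]_n) := (u *m H *m v^T) 0 0.
have BDl u v w : B (u + v) w = B u w + B v w.
  by rewrite /B !mulmxDl mxE.
have BDr u v w : B u (v + w) = B u v + B u w.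
  by rewrite /B linearD mulmxDr mxE.
have BZl a u v : B (a *: u) v = a * B u v.
  by rewrite /B -!scalemxAl mxE.
have BZr a u v : B u (a *: v) = a * B u v.
  by rewrite /B linearZ -!scalemxAr mxE.
pose e (p : 'I_n) : 'rV[R]_n := delta_mx 0 p.
have Be p q : B (e p) (e q) = H p q.
  by rewrite /B -rowE trmx_delta -colE !mxE.
have HC p q : H q p = H p q by rewrite -[in LHS]Hsym mxE.
(* Regrouped, YZ is the product of the coefficients of s^2 and t^2 in the binary form. *)
have -> : (H i k * H j l) * (H j k * H i l) = (H j k * H i k) * (H i l * H j l).
  by ring.
apply: disc_le_of_form_ge0 => [||s t]; rewrite ?mulr_ge0 //.
pose u := e i + e j.
(* The [H]-orthogonal projection of [s e_k + t e_l] away from [e_i, e_j],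
   scaled by [H i j]. *)
pose w := (s * H i j) *: e k + (t * H i j) *: e l
  + (- (s * H j k + t * H j l)) *: e i + (- (s * H i k + t * H i l)) *: e j.
have uu : 0 < B u u by rewrite !(BDl, BDr, Be) ii jj (HC i j); lra.
have uw : B u w = 0.
  rewrite !(BDl, BDr, BZr, Be) ii jj (HC i j); ring.
have := at_most_one_pos_eig_plane Hsym H1 uu uw.
rewrite -/(B w w) !(BDl, BDr, BZl, BZr, Be) ii jj kk.
rewrite !(HC i j, HC i k, HC j k, HC i l, HC j l, HC k l).
move=> ww; rewrite -(pmulr_rge0 _ ij).
(* [H l l] may be positive when [l] is the index of y; its term has the sign that allows dropping
   it. *)
have := mulr_ge0 (sqr_ge0 (t * H i j)) (H0 l l).
lra.
Qed.

(** By symmetry of the discriminant bound in X, Y, Z, any positive entry among [H i j], [H i k],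
    [H j k] can serve as pivot. If all three vanish, both sides are 0. *)
Lemma hessian_ineq n (H : 'M[R]_n) (i j k l : 'I_n) (r : R) :
  H^T = H -> at_most_one_pos_eig H -> (forall p q, 0 <= H p q) ->
  H i i = 0 -> H j j = 0 -> H k k = 0 ->
  r * (H i j * H k l)
  <= (r + 1) * (H j k * H i l) + r * (r + 1) * (H i k * H j l).
Proof.
move=> Hsym H1 H0 ii jj kk.
have HC p q : H q p = H p q by rewrite -[in LHS]Hsym mxE.
have [ij|ij] := ltrP 0 (H i j).
  apply: quad_ge0_of_disc; rewrite ?mulr_ge0 //.
  by have := hessian_disc l Hsym H1 H0 ii jj kk ij; lra.
have [ik|ik] := ltrP 0 (H i k).
  apply: quad_ge0_of_disc; rewrite ?mulr_ge0 //.
  by have := hessian_disc l Hsym H1 H0 ii kk jj ik; rewrite (HC j k); lra.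
have [jk|jk] := ltrP 0 (H j k).
  apply: quad_ge0_of_disc; rewrite ?mulr_ge0 //.
  have := hessian_disc l Hsym H1 H0 jj kk ii jk.
  by rewrite (HC i j) (HC i k); lra.
have H_eq0 p q : H p q <= 0 -> H p q = 0.
  by move=> pq; apply: le_anti; rewrite pq H0.
by rewrite (H_eq0 i j) // (H_eq0 i k) // (H_eq0 j k) // !mul0r !mulr0 addr0.
Qed.
End Quadric.

(** * Exponents and coefficients of f, and entries of Hessians *)

Section Coefficients.
Variables (R : realType) (n : nat).
Implicit Types (c : {set 'I_n} -> R) (S T V : {set 'I_n}).

Definition wid (i : 'I_n) : 'I_n.+1 := widen_ord (leqnSn n) i.

Lemma wid_inj : injective wid.
Proof. by move=> i j /(congr1 val) /= /val_inj. Qed.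

Lemma wid_neq_max i : (wid i == ord_max) = false.
Proof.
by apply/eqP => /(congr1 val) /= E; have := ltn_ord i; rewrite E ltnn.
Qed.

Lemma ord_wid_max (i : 'I_n.+1) : i = ord_max \/ exists j, i = wid j.
Proof.
have [->|] := eqVneq i ord_max; [by left | move=> ni; right].
have lt_in : (i < n)%N.
  rewrite ltn_neqAle -ltnS ltn_ord andbT.
  by apply: contra ni => /eqP E; apply/eqP/val_inj.
by exists (Ordinal lt_in); apply: val_inj.
Qed.

(* The exponent of x^([n] \ S) y^k. *)
Definition mon S (k : nat) : 'X_{1..n.+1} :=
  (\sum_(i in ~: S) U_(wid i) + U_(ord_max) *+ k)%MM.

Lemma mon_wid S k i : mon S k (wid i) = (i \notin S).
Proof.
rewrite mnmDE mnm_sumE mulmnE mnm1E eq_sym wid_neq_max mul0n addn0.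
under eq_bigr do rewrite mnm1E (inj_eq wid_inj).
rewrite -in_setC; case: (boolP (i \in ~: S)) => iS.
  rewrite (bigD1 i) //= eqxx big1 ?addn0 // => j /andP[_ /negPf ->] //.
by rewrite big1 // => j jS; case: eqP => // E; rewrite -E jS in iS.
Qed.

Lemma mon_max S k : mon S k ord_max = k.
Proof.
rewrite mnmDE mnm_sumE mulmnE mnm1E eqxx mul1n big1 ?add0n // => j _.
by rewrite mnm1E wid_neq_max.
Qed.

Lemma mdeg_mon S k : mdeg (mon S k) = (#|~: S| + k)%N.
Proof.
rewrite mdegD mdegMn mdeg1 mul1n mdeg_sum.
by under eq_bigr do rewrite mdeg1; rewrite sum1_card.
Qed.

Lemma mon_ext (m m' : 'X_{1..n.+1}) :
  m ord_max = m' ord_max -> (forall i, m (wid i) = m' (wid i)) -> m = m'.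
Proof.
by move=> mm mw; apply/mnmP => i; case: (ord_wid_max i) => [->|[j ->]].
Qed.

Lemma mon_inj S T k l : mon S k = mon T l -> S = T.
Proof.
move=> E; apply/setP => i; apply: negb_inj.
move/mnmP/(_ (wid i)): E; rewrite !mon_wid.
by case: (i \notin S); case: (i \notin T).
Qed.

Lemma fpolyE c : fpoly c = \sum_S c S *: 'X_[mon S #|S|].
Proof.
apply: eq_bigr => S _.
by rewrite mpolyXD -mpolyXn (big_morph _ (@mpolyXD _ R) (@mpolyX0 _ R)).
Qed.

Lemma mcoeff_fpoly c m :
  (fpoly c)@_m = \sum_S c S * (mon S #|S| == m)%:R.
Proof.
by rewrite fpolyE raddf_sum /=; apply: eq_bigr => S _; rewrite mcoeffZ mcoeffX.
Qed.

Lemma mcoeff_fpoly_mon c S : (fpoly c)@_(mon S #|S|) = c S.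
Proof.
rewrite mcoeff_fpoly (bigD1 S) //= eqxx mulr1 big1 ?addr0 // => T TS.
by case: eqP => [/mon_inj E|]; [rewrite E eqxx in TS | rewrite mulr0].
Qed.

Lemma mcoeff_fpoly_sqr c (m : 'X_{1..n.+1}) i :
  (1 < m (wid i))%N -> (fpoly c)@_m = 0.
Proof.
move=> mi; rewrite mcoeff_fpoly big1 // => S _.
case: eqP => [E|]; last by rewrite mulr0.
by move: mi; rewrite -E mon_wid; case: (_ \notin _).
Qed.

End Coefficients.

(** Only the constant term is read off, so each falling factorial from differentiation is a full
    factorial. *)
Lemma hessianE (R : realType) n (p : {mpoly R[n]}) (alpha : 'X_{1..n}) i j :
  hessian (mderivm alpha p) i j
  = p@_(alpha + U_(i) + U_(j))
    * (\prod_k ((alpha + U_(i) + U_(j))%MM k)`!)%N%:R.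
Proof.
rewrite mxE -!mderivmU1m -!mderivmDm mcoeff_mderivm addm0 mulr_natr.
rewrite [(U_(j) + _)%MM]addmC addmA.
by congr (_ *+ _); apply: eq_bigr => k _; rewrite ffactnn.
Qed.

Lemma hessian_sym (R : realType) n (p : {mpoly R[n]}) (alpha : 'X_{1..n}) :
  (hessian (mderivm alpha p))^T = hessian (mderivm alpha p).
Proof. 
apply/matrixP => i j; rewrite mxE !hessianE.
by rewrite -[(alpha + _ + _)%MM]addmA [(U_(j) + _)%MM]addmC addmA.
Qed.

(** * Lorentzian inequalities for the c_T, and the polynomial of the zero matrix *)

Section Lorentz.
Variables (R : realType) (n : nat).
Implicit Types (c : {set 'I_n} -> R) (S T V : {set 'I_n}).

Lemma prod_fact_mon S k : (\prod_i (mon S k i)`! = k`!)%N.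
Proof.
rewrite big_ord_recr /= mon_max big1 ?mul1n // => i _.
by rewrite [widen_ord _ _]/(wid i) mon_wid; case: (_ \notin _).
Qed.

Lemma mon_add2 V (a b : 'I_n) k : a \in V -> b \in V -> a != b ->
  (mon V k + U_(wid a) + U_(wid b))%MM = mon (V :\ a :\ b) k.
Proof.
move=> aV bV ab; apply: mon_ext => [|i].
  by rewrite 2!mnmDE !mon_max !mnm1E !wid_neq_max !addn0.
rewrite 2!mnmDE !mon_wid !mnm1E !(inj_eq (@wid_inj n)) !inE.
have [<-|ai] := eqVneq a i; first by rewrite (eq_sym b) (negPf ab) aV andbF.
by have [<-|bi] := eqVneq b i; rewrite ?bV //= !addn0 ?andbT.
Qed.

Lemma mon_add1 V (a : 'I_n) k : a \in V ->
  (mon V k + U_(wid a) + U_(ord_max))%MM = mon (V :\ a) k.+1.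
Proof.
move=> aV; apply: mon_ext => [|i].
  by rewrite 2!mnmDE !mon_max !mnm1E wid_neq_max eqxx addn0 addn1.
rewrite 2!mnmDE !mon_wid !mnm1E (inj_eq (@wid_inj n)).
rewrite [ord_max == _]eq_sym wid_neq_max !inE addn0.
by have [<-|] := eqVneq a i; rewrite ?aV // addn0.
Qed.

(** The subtraction truncates: the exponent has degree n - 2 only when [V] has at least two
    elements. *)
Definition slice c V := hessian (mderivm (mon V (#|V| - 2)) (fpoly c)).

Lemma slice_xx c V a b : a \in V -> b \in V -> a != b ->
  slice c V (wid a) (wid b) = c (V :\ a :\ b) * (#|V| - 2)`!%:R.
Proof.
move=> aV bV ab; rewrite /slice hessianE mon_add2 // prod_fact_mon.
have -> : (#|V| - 2)%N = #|V :\ a :\ b|.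
  rewrite (cardsD1 a V) (cardsD1 b (V :\ a)) aV !inE eq_sym ab bV /=.
  by rewrite !add1n subSS subSS subn0.
by rewrite mcoeff_fpoly_mon.
Qed.

Lemma slice_xy c V a : (1 < #|V|)%N -> a \in V ->
  slice c V (wid a) ord_max = c (V :\ a) * (#|V| - 1)`!%:R.
Proof.
move=> V1 aV; rewrite /slice hessianE mon_add1 // prod_fact_mon.
rewrite -subSn // subSS.
have -> : (#|V| - 1)%N = #|V :\ a|.
  by rewrite (cardsD1 a V) aV add1n subSS subn0.
by rewrite mcoeff_fpoly_mon.
Qed.

Lemma slice_diag c V a : slice c V (wid a) (wid a) = 0.
Proof.
rewrite /slice hessianE (@mcoeff_fpoly_sqr _ _ _ _ a) ?mul0r //.
by rewrite !mnmDE !mnm1E eqxx addn1 addn1.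
Qed.

Lemma lorentzian_slice c V (a b k : 'I_n) (l : 'I_n.+1) (r : R) :
  Lorentzian (fpoly c) n -> (1 < #|V|)%N ->
  let H := slice c V in
  r * (H (wid a) (wid b) * H (wid k) l)
  <= (r + 1) * (H (wid b) (wid k) * H (wid a) l)
     + r * (r + 1) * (H (wid a) (wid k) * H (wid b) l).
Proof.
move=> [_ [c0 L]] V1.
have Vn : (#|V| <= n)%N by rewrite -[leqRHS]card_ord max_card.
have [_ {}L] := L (leq_trans V1 Vn).
apply: hessian_ineq; rewrite ?slice_diag // /slice ?hessian_sym //.
  apply: L; rewrite mdeg_mon.
  rewrite -[in RHS](card_ord n) -[in RHS](cardsC V) addnC addnBAC //.
by move=> p q; rewrite hessianE mulr_ge0.
Qed.

Lemma lorentzian_ineq4 c V (a b k l : 'I_n) (r : R) :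
  Lorentzian (fpoly c) n -> uniq [:: a; b; k; l] ->
  {subset [:: a; b; k; l] <= V} ->
  r * c (V :\ a :\ b) * c (V :\ k :\ l)
  <= (r + 1) * c (V :\ b :\ k) * c (V :\ a :\ l)
     + r * (r + 1) * c (V :\ a :\ k) * c (V :\ b :\ l).
Proof.
move=> Lc /= /and4P[]; rewrite !inE !negb_or.
move=> /and3P[ab ak al] /andP[bk bl] kl _ sV.
have [aV bV kV lV] : [/\ a \in V, b \in V, k \in V & l \in V].
  by split; apply: sV; rewrite !inE eqxx ?orbT.
have V1 : (1 < #|V|)%N by rewrite (cardD1 a) aV (cardD1 b) !inE eq_sym ab bV.
have := lorentzian_slice a b k (wid l) r Lc V1.
rewrite /= !slice_xx //; set f : R := _%:R => ineq.
(* All three products consist of two x-x entries and share the factor [f * f]. *)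
have f0 : 0 < f * f by rewrite mulr_gt0 ?ltr0n ?fact_gt0.
rewrite -(ler_pM2r f0); lra.
Qed.

Lemma lorentzian_ineq3 c V (a b k : 'I_n) (r : R) :
  Lorentzian (fpoly c) n -> uniq [:: a; b; k] ->
  {subset [:: a; b; k] <= V} ->
  r * c (V :\ a :\ b) * c (V :\ k)
  <= (r + 1) * c (V :\ b :\ k) * c (V :\ a)
     + r * (r + 1) * c (V :\ a :\ k) * c (V :\ b).
Proof.
move=> Lc /= /and3P[]; rewrite !inE !negb_or => /andP[ab ak] bk _ sV.
have [aV bV kV] : [/\ a \in V, b \in V & k \in V].
  by split; apply: sV; rewrite !inE eqxx ?orbT.
have V1 : (1 < #|V|)%N by rewrite (cardD1 a) aV (cardD1 b) !inE eq_sym ab bV.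
have := lorentzian_slice a b k ord_max r Lc V1.
rewrite /= !slice_xx // !slice_xy //.
set f : R := _%:R; set g : R := _%:R => ineq.
(* Each product pairs an x-x entry with an x-y entry, whence the common factor [f * g]. *)
have f0 : 0 < f * g by rewrite mulr_gt0 ?ltr0n ?fact_gt0.
rewrite -(ler_pM2r f0); lra.
Qed.

Lemma principal_minor0 S : principal_minor (0 : 'M[R]_n) S = (S == set0)%:R.
Proof.
rewrite /principal_minor (_ : mxsub _ _ _ = 0); last first.
  by apply/matrixP => i j; rewrite !mxE.
have [->|S0] := eqVneq S set0; first by rewrite cards0 det_mx00.
rewrite -cards_eq0 in S0; case: #|S| S0 => // m _.
by rewrite det0.
Qed.

Lemma fpoly_minor0 : fpoly (principal_minor (0 : 'M[R]_n)) = 'X_[mon set0 0].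
Proof.
rewrite fpolyE (bigD1 set0) //= principal_minor0 eqxx scale1r cards0.
by rewrite big1 ?addr0 // => S /negPf S0; rewrite principal_minor0 S0 scale0r.
Qed.

Lemma Lorentzian_minor0 : Lorentzian (fpoly (principal_minor (0 : 'M[R]_n))) n.
Proof.
rewrite fpoly_minor0; split; [|split=> [mu|n2]].
- move=> mu; rewrite msuppX inE => /eqP ->.
  by rewrite mdeg_mon addn0 setC0 cardsT card_ord.
- by rewrite mcoeffX ler0n.
split=> [al be|al _].
  by rewrite msuppX !inE => /eqP -> /eqP -> i; rewrite ltnn.
pose m0 := mon (set0 : {set 'I_n}) 0.
(* If [m0] = [al] + e_i + e_j, a nonzero entry must raise the exponent of [i], so it lies in row or
   column [i]. If there is no such pair, the Hessian is 0 and any index will do. *)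
have [[i j] /= /eqP ij|none] :=
    pickP (fun p : 'I_n.+1 * 'I_n.+1 => m0 == (al + U_(p.1) + U_(p.2))%MM).
  apply: (@at_most_one_pos_eig_cross _ _ _ i);
    rewrite ?hessian_sym // => p q pi qi.
  rewrite hessianE mcoeffX; case: eqP => [|_]; last by rewrite mul0r.
  rewrite -/m0 ij => /mnmP/(_ i)/eqP; rewrite !mnmDE !mnm1E eqxx.
  by rewrite (negPf pi) (negPf qi) !addn0 -addnA -[X in _ == X]addn0 eqn_add2l.
apply: (@at_most_one_pos_eig_cross _ _ _ ord_max);
  rewrite ?hessian_sym // => p q _ _.
by rewrite hessianE mcoeffX -/m0 (none (p, q)) mul0r.
Qed.
End Lorentz.

(** The case [p = q] is allowed and serves to remove a single element in the three-index
    inequality. *)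
Lemma setU_setD2 (T : finType) (S X Y : {set T}) (p q : T) :
  [disjoint S & X] -> p \in X -> q \in X ->
  (forall i, (i \in Y) = [&& i != p, i != q & i \in X]) ->
  S :|: Y = (S :|: X) :\ p :\ q.
Proof.
move=> dSX pX qX YE; apply/setP => i; rewrite !inE YE.
have SX j : j \in X -> (j \in S) = false by move/(disjointFl dSX).
have [->|_] := eqVneq i p; first by rewrite andbF (SX _ pX).
by have [->|_] := eqVneq i q; first by rewrite (SX _ qX).
Qed.

(** * The inequalities in terms of S, and their tightness *)

Section Main.
Variables (R : realType) (n : nat).
Implicit Types (c : {set 'I_n} -> R) (S : {set 'I_n}).

Lemma Lorentzian_gap4 c : Lorentzian (fpoly c) n ->
  forall (a b k l : 'I_n), uniq [:: a; b; k; l] ->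
  forall S, [disjoint S & [set a; b; k; l]] ->
  forall r : R,
    r * c (S :|: [set a; b]) * c (S :|: [set k; l])
    <= (r + 1) * c (S :|: [set a; l]) * c (S :|: [set b; k])
       + r * (r + 1) * c (S :|: [set a; k]) * c (S :|: [set b; l]).
Proof.
move=> Lc a b k l U S dS r; set V := S :|: [set a; b; k; l].
have sV : {subset [:: a; b; k; l] <= V}.
  by move=> i; rewrite /V !inE -!orbA => ->; rewrite orbT.
have := lorentzian_ineq4 r Lc U sV.
have /and4P[] : uniq [:: a; b; k; l] := U; rewrite !inE !negb_or.
move=> /and3P[/negPf ab /negPf ak /negPf al] /andP[/negPf bk /negPf bl] /negPf kl _.
have sym := (ab, ak, al, bk, bl, kl).
have VE (p q : 'I_n) (Y : {set 'I_n}) :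
    p \in [set a; b; k; l] -> q \in [set a; b; k; l] ->
    (forall i, (i \in Y) = [&& i != p, i != q & i \in [set a; b; k; l]]) ->
    V :\ p :\ q = S :|: Y by move=> pX qX YE; rewrite (setU_setD2 dS pX qX YE).
rewrite (VE a b [set k; l]) ?(VE k l [set a; b]) ?(VE b k [set a; l])
  ?(VE a l [set b; k]) ?(VE a k [set b; l]) ?(VE b l [set a; k]); first by lra.
(* The set identities are decided by comparing [i] with each index in turn; [sym] supplies
   distinctness. *)
all: rewrite ?inE ?eqxx ?orbT // => i; rewrite !inE.
all: have [->|ia] := eqVneq i a; rewrite ?sym //=.
all: have [->|ib] := eqVneq i b; rewrite ?sym //=.
all: have [->|ik] := eqVneq i k; rewrite ?sym //=.
all: by case: (eqVneq i l).
Qed.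

Lemma Lorentzian_gap3 c : Lorentzian (fpoly c) n ->
  forall (a b k : 'I_n), uniq [:: a; b; k] ->
  forall S, [disjoint S & [set a; b; k]] ->
  forall r : R,
    r * c (S :|: [set k]) * c (S :|: [set a; b])
    <= (r + 1) * c (S :|: [set a]) * c (S :|: [set b; k])
       + r * (r + 1) * c (S :|: [set b]) * c (S :|: [set a; k]).
Proof.
move=> Lc a b k U S dS r; set V := S :|: [set a; b; k].
have sV : {subset [:: a; b; k] <= V}.
  by move=> i; rewrite /V !inE -!orbA => ->; rewrite orbT.
have := lorentzian_ineq3 r Lc U sV.
have /and3P[] : uniq [:: a; b; k] := U; rewrite !inE !negb_or.
move=> /andP[/negPf ab /negPf ak] /negPf bk _.
have sym := (ab, ak, bk).
have VE (p q : 'I_n) (Y : {set 'I_n}) :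
    p \in [set a; b; k] -> q \in [set a; b; k] ->
    (forall i, (i \in Y) = [&& i != p, i != q & i \in [set a; b; k]]) ->
    V :\ p :\ q = S :|: Y by move=> pX qX YE; rewrite (setU_setD2 dS pX qX YE).
have VE1 (p : 'I_n) (Y : {set 'I_n}) :
    p \in [set a; b; k] ->
    (forall i, (i \in Y) = [&& i != p, i != p & i \in [set a; b; k]]) ->
    V :\ p = S :|: Y.
  by move=> pX /(VE _ _ _ pX pX) <-; rewrite setDDl setUid.
rewrite (VE a b [set k]) ?(VE b k [set a]) ?(VE a k [set b])
  ?(VE1 k [set a; b]) ?(VE1 a [set b; k]) ?(VE1 b [set a; k]); first by lra.
all: rewrite ?inE ?eqxx ?orbT // => i; rewrite !inE.
all: have [->|ia] := eqVneq i a; rewrite ?sym //=.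
all: have [->|ib] := eqVneq i b; rewrite ?sym //=.
all: by case: (eqVneq i k).
Qed.

Lemma psd0 : psd (0 : 'M[R]_n).
Proof. by split=> [|v]; rewrite ?trmx0 // mulmx0 mul0mx mxE. Qed.

Lemma principal_minor0_setU S (T : {set 'I_n}) i :
  i \in T -> principal_minor (0 : 'M[R]_n) (S :|: T) = 0.
Proof.
move=> iT; rewrite principal_minor0; case: eqP => // /setP/(_ i).
by rewrite !inE iT orbT.
Qed.
End Main.

Theorem theorem5p1 (R : realType) :
  (* inequality with four indices *)
  (forall (n : nat) (c : {set 'I_n} -> R),
     Lorentzian (fpoly c) n -> (4 <= n)%N ->
     forall (a b c' d : 'I_n), uniq [:: a; b; c'; d] ->
     forall S : {set 'I_n}, [disjoint S & [set a; b; c'; d]] ->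
     forall r : R,
       r * c (S :|: [set a; b]) * c (S :|: [set c'; d])
       <= (r + 1) * c (S :|: [set a; d]) * c (S :|: [set b; c'])
          + r * (r + 1) * c (S :|: [set a; c']) * c (S :|: [set b; d])) /\
  (* inequality with three indices *)
  (forall (n : nat) (c : {set 'I_n} -> R),
     Lorentzian (fpoly c) n -> (3 <= n)%N ->
     forall (a b c' : 'I_n), uniq [:: a; b; c'] ->
     forall S : {set 'I_n}, [disjoint S & [set a; b; c']] ->
     forall r : R,
       r * c (S :|: [set c']) * c (S :|: [set a; b])
       <= (r + 1) * c (S :|: [set a]) * c (S :|: [set b; c'])
          + r * (r + 1) * c (S :|: [set b]) * c (S :|: [set a; c'])) /\
  (* tightness of the first inequality on the PSD-minor subclass:
     the infimum of LHS - RHS over the subclass is 0 *)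
  (forall (n : nat), (4 <= n)%N ->
     forall (a b c' d : 'I_n), uniq [:: a; b; c'; d] ->
     forall S : {set 'I_n}, [disjoint S & [set a; b; c'; d]] ->
     forall r : R,
       (forall A : 'M[R]_n, psd A -> Lorentzian (fpoly (principal_minor A)) n ->
          0 <= gap4 (principal_minor A) a b c' d S r) /\
       (forall eps : R, 0 < eps ->
          exists A : 'M[R]_n, psd A /\ Lorentzian (fpoly (principal_minor A)) n /\
            gap4 (principal_minor A) a b c' d S r < eps)) /\
  (* tightness of the second inequality *)
  (forall (n : nat), (3 <= n)%N ->
     forall (a b c' : 'I_n), uniq [:: a; b; c'] ->
     forall S : {set 'I_n}, [disjoint S & [set a; b; c']] ->
     forall r : R,
       (forall A : 'M[R]_n, psd A -> Lorentzian (fpoly (principal_minor A)) n ->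
          0 <= gap3 (principal_minor A) a b c' S r) /\
       (forall eps : R, 0 < eps ->
          exists A : 'M[R]_n, psd A /\ Lorentzian (fpoly (principal_minor A)) n /\
            gap3 (principal_minor A) a b c' S r < eps)).
Proof.
split; first by move=> n c Lc _; apply: Lorentzian_gap4.
split; first by move=> n c Lc _; apply: Lorentzian_gap3.
split=> n _.
  move=> a b k l U S dS r; split=> [A _ LA|eps eps0].
    by rewrite /gap4 subr_ge0; apply: Lorentzian_gap4.
  (* Every product in the gap contains a minor on a nonempty set, which is 0 here; the gap is
     exactly 0 and the infimum is attained. *)
  exists 0; split; [exact: psd0 | split; first exact: Lorentzian_minor0].
  rewrite /gap4 (principal_minor0_setU _ _ (set21 a l)).
  rewrite (principal_minor0_setU _ _ (set21 a k)).
  by rewrite (principal_minor0_setU _ _ (set21 a b)) !(mulr0, mul0r, addr0, subr0).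
move=> a b k U S dS r; split=> [A _ LA|eps eps0].
  by rewrite /gap3 subr_ge0; apply: Lorentzian_gap3.
exists 0; split; [exact: psd0 | split; first exact: Lorentzian_minor0].
rewrite /gap3 (principal_minor0_setU _ _ (set11 a)).
rewrite (principal_minor0_setU _ _ (set11 b)).
by rewrite (principal_minor0_setU _ _ (set11 k)) !(mulr0, mul0r, addr0, subr0).
Qed.
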